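(* There exists an infinitely generated torsion-free Fuchsian group $\Gamma<\mathrm{Isom}^+(\mathbb{H})$ such that ${\rm HD}(\Lambda^\tau_\Gamma)=0$.
   Context: $\mathbb{H}$ is the hyperbolic plane, with boundary at infinity $\partial_\infty\mathbb{H}$. Fix $o\in\mathbb{H}$. The limit set is $\Lambda_\Gamma=\overline{\Gamma\cdot o}\setminus\Gamma\cdot o$. For $\xi\in\partial_\infty\mathbb{H}$ let $\xi_t$ be the point of the geodesic ray $[o,\xi)$ at distance $t$ from $o$ and $\Delta(\xi_t)=d(\xi_t,\Gamma\cdot o)$. The transient limit set is $\Lambda^\tau_\Gamma=\{\xi\in\Lambda_\Gamma:\lim_{t\to\infty}\Delta(\xi_t)=\infty\}$. Hausdorff dimension is taken with respect to a visual metric on the boundary (equivalently, the Euclidean metric on $\mathbb{R}$ in the upper half-plane model, locally). *)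

(* Defs.v *)
From HB Require Import structures.
From mathcomp Require Import all_boot all_order all_algebra.
From mathcomp Require Import all_classical all_reals all_analysis.
Set Implicit Arguments. Unset Strict Implicit. Unset Printing Implicit Defensive.
Import Order.TTheory GRing.Theory Num.Theory.
Local Open Scope classical_set_scope.
Local Open Scope ring_scope.

Section Hyp.
Variable R : realType.

(* A point z = x + i y of H is the pair (x, y) with y > 0. *)
Definition hplane : set (R * R) := [set p | 0 < p.2].

(* hyperbolic distance: cosh d = 1 + |z - w|^2 / (2 Im z Im w),
   and arcosh u = ln (u + sqrt (u^2 - 1)). *)
Definition hdist (p q : R * R) : R :=
  let u := 1 + ((p.1 - q.1) ^+ 2 + (p.2 - q.2) ^+ 2) / (2 * p.2 * q.2) in
  ln (u + Num.sqrt (u ^+ 2 - 1)).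

Definition i0 : 'I_2 := ord0.
Definition i1 : 'I_2 := ord_max.

(* g = (a b; c d) acts by z |-> (a z + b)/(c z + d). *)
Definition mob (g : 'M[R]_2) (p : R * R) : R * R :=
  let a := g i0 i0 in let b := g i0 i1 in
  let c := g i1 i0 in let d := g i1 i1 in
  let den := (c * p.1 + d) ^+ 2 + (c * p.2) ^+ 2 in
  (((a * p.1 + b) * (c * p.1 + d) + a * c * p.2 ^+ 2) / den, p.2 / den).

(* A subgroup of PSL(2,R) is encoded by its full preimage Gamma in SL(2,R)
   (a subgroup of SL(2,R) containing -1). *)
Definition PSL2_subgroup (G : set 'M[R]_2) : Prop :=
  [/\ forall g, G g -> \det g = 1,
      G 1%:M, G (- 1%:M),
      forall g h, G g -> G h -> G (g *m h)
    & forall g, G g -> G (invmx g)].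

Definition discrete_group (G : set 'M[R]_2) : Prop :=
  forall g, G g -> exists2 e : R, 0 < e &
    forall h, G h -> (forall i j, `|h i j - g i j| < e) -> h = g.

Definition Fuchsian (G : set 'M[R]_2) : Prop :=
  PSL2_subgroup G /\ discrete_group G.

Definition torsion_free (G : set 'M[R]_2) : Prop :=
  forall g, G g -> forall n : nat, (0 < n)%N ->
    (g ^+ n = 1%:M \/ g ^+ n = - 1%:M) -> (g = 1%:M \/ g = - 1%:M).

Inductive gen (S : set 'M[R]_2) : set 'M[R]_2 :=
| gen_one : gen S 1%:M
| gen_neg : gen S (- 1%:M)
| gen_base g : S g -> gen S g
| gen_mul g h : gen S g -> gen S h -> gen S (g *m h)
| gen_inv g : gen S g -> gen S (invmx g).

Definition finitely_generated (G : set 'M[R]_2) : Prop :=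
  exists s : seq 'M[R]_2,
    (forall g, g \in s -> G g) /\ G `<=` gen [set g | g \in s].

Definition infinitely_generated (G : set 'M[R]_2) : Prop :=
  ~ finitely_generated G.

(* The boundary at infinity is R u {oo}; a finite boundary point xi is
   in the closure of the orbit Gamma.o iff orbit points come Euclidean-close
   to (xi, 0). (No boundary point lies in the orbit itself.) *)
Definition limit_point (G : set 'M[R]_2) (o : R * R) (xi : R) : Prop :=
  forall e : R, 0 < e -> exists2 g, G g &
    `|(mob g o).1 - xi| < e /\ (mob g o).2 < e.

Definition geodesic_ray (o : R * R) (xi : R) (gam : R -> R * R) : Prop :=
  [/\ gam 0 = o,
      forall t, 0 <= t -> hplane (gam t),
      forall s t, 0 <= s -> 0 <= t -> hdist (gam s) (gam t) = `|s - t|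
    & forall e : R, 0 < e -> exists M : R, forall t, M <= t ->
        `|(gam t).1 - xi| < e /\ (gam t).2 < e].

Definition transient_limit_point (G : set 'M[R]_2) (o : R * R) (xi : R) : Prop :=
  limit_point G o xi /\
  forall gam, geodesic_ray o xi gam ->
    forall K : R, exists T : R, forall t, T <= t ->
      forall g, G g -> K <= hdist (gam t) (mob g o).

Definition transient_limit_set (G : set 'M[R]_2) (o : R * R) : set R :=
  [set xi | transient_limit_point G o xi].

Definition delta_cover (delta : R) (A : set R) (U : nat -> set R) (r : nat -> R) :=
  A `<=` \bigcup_n U n /\
  forall n, [/\ 0 <= r n, r n <= delta &
               forall x y, U n x -> U n y -> `|x - y| <= r n].

Definition hausdorff_content (s delta : R) (A : set R) : \bar R :=
  ereal_inf [set (\sum_(n <oo) ((r n) `^ s)%:E)%E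
            | r in [set r | exists U, delta_cover delta A U r]].

Definition hausdorff_measure (s : R) (A : set R) : \bar R :=
  ereal_sup [set hausdorff_content s delta A | delta in [set d : R | 0 < d]].

Definition hausdorff_dim (A : set R) : \bar R :=
  ereal_inf [set s%:E | s in [set s : R | 0 <= s /\ hausdorff_measure s A = 0%E]].

End Hyp.

(* Main.v *)
(* The group is generated by g_a = [[a, a^2 - 1], [1, a]], that is
   z |-> a - 1/(z + a), for a = +-(4^(n+2) + 1); up to sign g_a^-1 = g_(-a).
   All matrices are integral, hence discreteness; they have upper right entry
   divisible by 4, so all traces are 2 mod 4, hence no torsion.  Ping-pong on the
   intervals around the letters a shows that a reduced word sends oo close to its
   first letter, so the group is infinitely generated, and every limit point is
   coded by a finite or infinite reduced word.  If an infinite code contains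
   bounded letters infinitely often, every ray to the point returns to a compact
   part of the quotient.  Hence the code of a transient limit point is finite or
   has letters tending to infinity.  The contraction ratios of the letters decay
   exponentially with n, so for every s > 0 the points coded by sufficiently large
   letters have s-measure 0, and the transient limit set is a countable union of
   images of such sets under 1-Lipschitz maps, up to a countable set. *)
Require Import Defs.
From HB Require Import structures.
From mathcomp Require Import all_boot all_order all_algebra.
From mathcomp Require Import all_classical all_reals all_analysis.
From mathcomp Require Import zify ring lra.
Set Implicit Arguments. Unset Strict Implicit. Unset Printing Implicit Defensive.
Import Order.TTheory GRing.Theory Num.Theory.
Local Open Scope classical_set_scope.
Local Open Scope ring_scope.

(** * Two-by-two matrices and powers in SL(2) *)

Section Matrix2.
Variable T : nzRingType.
Implicit Types A B : 'M[T]_2.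

Definition mx2 (a b c d : T) : 'M[T]_2 :=
  \matrix_(i < 2, j < 2)
    if i == i0 then (if j == i0 then a else b) else (if j == i0 then c else d).

Lemma mx2E a b c d :
  (mx2 a b c d i0 i0 = a) * (mx2 a b c d i0 i1 = b) *
  (mx2 a b c d i1 i0 = c) * (mx2 a b c d i1 i1 = d).
Proof. by rewrite !mxE. Qed.

Lemma mx2P A B : A i0 i0 = B i0 i0 -> A i0 i1 = B i0 i1 ->
  A i1 i0 = B i1 i0 -> A i1 i1 = B i1 i1 -> A = B.
Proof.
move=> h00 h01 h10 h11; apply/matrixP => i j.
have ordE (k : 'I_2) : k = i0 \/ k = i1.
  by case: k => [[|[|//]] hk]; [left|right]; exact: val_inj.
by case: (ordE i) => ->; case: (ordE j) => ->.
Qed.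

Lemma mulmx2E A B i j : (A *m B) i j = A i i0 * B i0 j + A i i1 * B i1 j.
Proof.
rewrite mxE big_ord_recl big_ord1; congr (_ + A i _ * B _ j); exact: val_inj.
Qed.

End Matrix2.

Lemma det_mx2 (T : comNzRingType) (A : 'M[T]_2) :
  \det A = A i0 i0 * A i1 i1 - A i0 i1 * A i1 i0.
Proof.
rewrite (expand_det_row _ i0) big_ord_recl big_ord1 /cofactor !det_mx11 !mxE /=.
have l0 (k : 'I_1) : lift i0 k = i1 by apply: val_inj; rewrite (ord1 k).
have l1 (k : 'I_1) : lift i1 k = i0 by apply: val_inj; rewrite (ord1 k).
rewrite -/i0 !l0 !l1 expr0 expr1.
by ring.
Qed.

(* By Cayley-Hamilton, g ^ n = u_n g - u_(n-1) with u_(n+1) = t u_n - u_(n-1);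
   for |t| >= 2 the sequence |u_n| is strictly increasing, so g ^ n can only be
   scalar if g is. *)
Lemma trace_ge2_torsion_free (R : realFieldType) (g : 'M[R]_2) :
  \det g = 1 -> 2 <= `|g i0 i0 + g i1 i1| ->
  forall n, (0 < n)%N -> (g ^+ n = 1%:M \/ g ^+ n = - 1%:M) ->
  g = 1%:M \/ g = - 1%:M.
Proof.
move=> dg tg n n0 gn.
set t := g i0 i0 + g i1 i1 in tg.
have CH : g * g = t *: g - 1%:M.
  move: dg; rewrite det_mx2 => /(canRL (subrK _)) dg; rewrite (_ : g * g = g *m g) //.
  by apply: mx2P; rewrite mulmx2E !mxE /t /= ?mulr1n ?mulr0n; ring: dg.
have [u [v [gnE uv]]] : exists u v : R,
    g ^+ n = u *: g - v *: 1%:M /\ `|v| + 1 <= `|u|.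
  case: n n0 {gn} => // n _; elim: n => [|n [u [v [IH uv]]]].
    by exists 1, 0; rewrite expr1 scale1r scale0r subr0 normr0 normr1 add0r.
  exists (t * u - v), u; split.
    rewrite exprSr IH mulrBl -scalerAl CH -scalerAl.
    rewrite (_ : 1%:M * g = g); last exact: mul1mx.
    by rewrite scalerBr scalerA scalerBl mulrC addrAC.
  have := lerB_dist (t * u) v; rewrite normrM.
  have : 2 * `|u| <= `|t| * `|u| by rewrite ler_wpM2r.
  by move=> ? ?; lra.
have u0 : u != 0.
  by rewrite -normr_gt0; apply: lt_le_trans uv; rewrite ltr_wpDl.
have gS : exists l : R, g = l%:M.
  have : exists k : R, u *: g = k%:M.
    have {}gnE : u *: g = g ^+ n + v *: 1%:M by rewrite gnE subrK.
    case: gn gnE => -> ->; [exists (1 + v)|exists (- 1 + v)].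
      by rewrite scalemx1 raddfD.
    by rewrite scalemx1 raddfD raddfN.
  move=> [k hk]; exists (u^-1 * k).
  by rewrite -scale_scalar_mx -hk scalerA mulVf // scale1r.
case: gS => l gl; move: dg; rewrite det_mx2 gl !mxE /= => /eqP.
rewrite mulr1n mulr0n mul0r subr0 -expr2 sqrf_eq1 => /orP[] /eqP ->; [by left|right].
by rewrite raddfN.
Qed.

(** * Letters, ping-pong estimates and reduced words *)

Section Words.
Variable R : realType.

Definition letter := (bool * nat)%type.
Definition lopp (a : letter) : letter := (~~ a.1, a.2).
(** The boolean is the sign. The modulus is 1 mod 4, which makes [lint a ^ 2 - 1] divisible by 4,
    and its exponential growth drives all later contraction estimates. *)
Definition lint (a : letter) : int := (-1) ^+ a.1 * (4 ^+ a.2.+2 + 1).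
Definition lval (a : letter) : R := (lint a)%:~R.

Lemma loppK : involutive lopp.
Proof. by case=> s n; rewrite /lopp negbK. Qed.

Lemma lint_opp a : lint (lopp a) = - lint a.
Proof. by case: a => [[] n]; rewrite /lint /= ?expr1 ?expr0 mul1r ?mulN1r ?opprK. Qed.

Lemma lval_opp a : lval (lopp a) = - lval a.
Proof. by rewrite /lval lint_opp mulrNz. Qed.

Lemma lvalE a : lval a = (-1) ^+ a.1 * (4 * 4 ^+ a.2.+1 + 1).
Proof.
rewrite /lval /lint -exprS intrM intrD /= !rmorphXn /=.
by rewrite rmorphN.
Qed.

Lemma expr4_ge1 n : 1 <= 4 ^+ n :> R.
Proof. by apply: exprn_ege1; lra. Qed.

(** Equal signs add the moduli. Opposite signs force distinct indices; the worst case is [b] of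
    index one less than [a], where the gap is exactly (4 - 1) 4^(m+1) with m = [a.2]. *)
Lemma lval_gap a b : b != lopp a -> 3 * 4 ^+ a.2.+1 <= `|lval a + lval b|.
Proof.
case: a b => s m [s' n] /=; rewrite xpair_eqE negb_and /= !lvalE /= => h.
have := expr4_ge1 m.+1; have := expr4_ge1 n.+1.
have lt4 i j : (i < j)%N -> 4 * 4 ^+ i.+1 <= 4 ^+ j.+1 :> R.
  by move=> ij; rewrite -exprS ler_weXn2l //; lra.
set x : R := 4 ^+ m.+1; set y : R := 4 ^+ n.+1 => y1 x1.
have ss : s == s' -> 3 * x <= `|(-1) ^+ s * (4 * x + 1) + (-1) ^+ s' * (4 * y + 1)|.
  move/eqP <-; rewrite -mulrDr normrM normr_sign mul1r ger0_norm; lra.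
case: (boolP (s == s')) => [/ss //|ns].
have mn : m != n by move: h; case: (s') (s) ns => [] [] //=; rewrite eq_sym.
have -> : (-1) ^+ s * (4 * x + 1) + (-1) ^+ s' * (4 * y + 1) =
          (-1) ^+ s * (4 * x - 4 * y).
  by case: (s') (s) ns => [] [] //= _; rewrite ?expr1 ?expr0; ring.
rewrite normrM normr_sign mul1r.
case: (ltngtP m n) mn => // /lt4; rewrite -/x -/y => h1 _.
  by rewrite ler0_norm; lra.
by rewrite ger0_norm; lra.
Qed.

Lemma lval_sep a b : `|lval a - lval b| < 3 -> a = b.
Proof.
move=> h; apply/eqP; apply: contraTT h => ab; rewrite -leNgt -lval_opp.
have /lval_gap : lopp b != lopp a by rewrite (inj_eq (can_inj loppK)) eq_sym.
by apply: le_trans; have := expr4_ge1 a.2.+1; lra.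
Qed.

(** The ping-pong estimate: it bounds below the denominator of [phi a] on the interval around any
    letter allowed to follow [a]. *)
Lemma lval_far a b x : b != lopp a -> `|x - lval b| <= 1 / 2 ->
  8 * 4 ^+ a.2 <= `|x + lval a|.
Proof.
move=> /lval_gap; rewrite exprS; have := expr4_ge1 a.2.
have e : lval a + lval b = (x + lval a) - (x - lval b) by ring.
by have := ler_normB (x + lval a) (x - lval b); rewrite -e; lra.
Qed.

(* The generator letmx a acts on the boundary by
   (l x + l^2 - 1) / (x + l) = l - 1 / (x + l), where l = lval a. *)
Definition phi (a : letter) (x : R) : R := lval a - (x + lval a)^-1.
(** The inverse of [phi a]. Since 0^-1 = 0, the pole of [phi a] goes to [lval a] and back, so both
    cancellation laws hold without side conditions. *)
Definition psi (a : letter) (x : R) : R := - lval a - (x - lval a)^-1.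

Lemma phiK a x : psi a (phi a x) = x.
Proof.
rewrite /phi /psi (_ : _ - _ - _ = - (x + lval a)^-1); last by ring.
by rewrite invrN invrK opprK addrC addrK.
Qed.

Lemma psiK a x : phi a (psi a x) = x.
Proof.
rewrite /phi /psi (_ : - _ - _ + _ = - (x - lval a)^-1); last by ring.
by rewrite invrN invrK opprK addrC subrK.
Qed.

Lemma psi_addE a x : psi a x + lval a = - (x - lval a)^-1.
Proof. by rewrite /psi; ring. Qed.

Lemma phi_dist a x y : x + lval a != 0 -> y + lval a != 0 ->
  `|phi a x - phi a y| = `|x - y| / (`|x + lval a| * `|y + lval a|).
Proof.
move=> hx hy; rewrite -normrM -normfV -normrM; congr `|_|.
by rewrite /phi; field; rewrite hx hy.
Qed.

Definition reduced (w : seq letter) := sorted (fun a b => b != lopp a) w.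

(* endv w is the image of oo under wordmx w; the value 0 at [::] is junk. *)
Fixpoint endv (w : seq letter) : R :=
  if w is a :: w' then (if w' is [::] then lval a else phi a (endv w')) else 0.

Lemma endv_near a w : reduced (a :: w) -> `|endv (a :: w) - lval a| <= 1 / 8.
Proof.
elim: w a => [|b w IH] a; first by rewrite /= subrr normr0; lra.
rewrite /reduced /= => /andP[ba /IH].
rewrite -/(endv (b :: w)); set x := endv _ => hx.
rewrite /phi addrAC subrr add0r normrN normfV.
have : `|x - lval b| <= 1 / 2 by lra.
move=> /(lval_far ba) h; have := expr4_ge1 a.2 => h1.
rewrite mul1r lef_pV2 ?posrE //; lra.
Qed.

Definition letmx (a : letter) : 'M[R]_2 := mx2 (lval a) (lval a ^+ 2 - 1) 1 (lval a).
Definition wordmx (w : seq letter) : 'M[R]_2 := foldr (fun a g => letmx a *m g) 1%:M w.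
Definition gens (P : set nat) : set 'M[R]_2 := [set letmx a | a in [set a | P a.2]].

Lemma det_letmx a : \det (letmx a) = 1.
Proof. by rewrite det_mx2 !mx2E; ring. Qed.

Lemma letmx_opp a : letmx a *m letmx (lopp a) = - 1%:M.
Proof.
by apply: mx2P; rewrite mulmx2E !mx2E !mxE /= lval_opp ?mulr1n ?mulr0n; ring.
Qed.

Lemma invmx_letmx a : invmx (letmx a) = - letmx (lopp a).
Proof.
have u : letmx a \in unitmx by rewrite unitmxE det_letmx unitr1.
by apply: (can_inj (mulKmx u)); rewrite mulmxV // mulmxN letmx_opp opprK.
Qed.

Lemma det_wordmx w : \det (wordmx w) = 1.
Proof. by elim: w => [|a w IH]; rewrite /= ?det1 // det_mulmx det_letmx IH mulr1. Qed.

(** The first column of a matrix is the image of oo in homogeneous coordinates; reducedness keeps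
    each successive denominator away from 0. *)
Lemma wordmx_endv a w : reduced (a :: w) ->
  wordmx (a :: w) i1 i0 != 0 /\
  wordmx (a :: w) i0 i0 = endv (a :: w) * wordmx (a :: w) i1 i0.
Proof.
elim: w a => [|b w IH] a; first by rewrite /= mulmx1 !mx2E mulr1 oner_neq0.
rewrite /reduced [sorted _ _]/= => /andP[ba rw]; have [q0 pq] := IH _ rw.
have hx : endv (b :: w) + lval a != 0.
  have : `|endv (b :: w) - lval b| <= 1 / 2 by have := endv_near rw; lra.
  move=> /(lval_far ba); have := expr4_ge1 a.2; rewrite -normr_gt0; lra.
have -> : wordmx [:: a, b & w] = letmx a *m wordmx (b :: w) by [].
have -> : endv [:: a, b & w] = phi a (endv (b :: w)) by [].
move: (wordmx (b :: w)) (endv (b :: w)) q0 pq hx => W x q0 pq hx.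
rewrite !mulmx2E !mx2E pq; split.
  by rewrite (_ : _ + _ = (x + lval a) * W i1 i0); [rewrite mulf_neq0|ring].
by rewrite /phi; field.
Qed.

Lemma gen_det (S : set 'M[R]_2) g :
  (forall h, S h -> \det h = 1) -> gen S g -> \det g = 1.
Proof.
move=> S1; elim=> [||h /S1//|h k _ hh _ hk|h _ hh].
- by rewrite det1.
- by rewrite det_mx2 !mxE /= mulr1n mulr0n; ring.
- by rewrite det_mulmx hh hk mulr1.
- by rewrite det_inv hh invr1.
Qed.

Lemma gens_det P g : gens P g -> \det g = 1.
Proof. by case=> a _ <-; exact: det_letmx. Qed.

Lemma gen_wordmx P w : all (fun a => `[< P a.2 >]) w -> gen (gens P) (wordmx w).
Proof.
elim: w => [_|a w IH /= /andP[/asboolP Pa /IH Pw]]; first exact: gen_one.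
by apply: gen_mul => //; apply: gen_base; exists a.
Qed.

(** Left multiplication by a generator either prepends a letter or, up to sign, cancels the first
    one. Quantifying over the word acted upon, as in [Q], makes the property stable under
    products. *)
Lemma gen_reduced P g : gen (gens P) g -> exists w,
  [/\ reduced w, all (fun a => `[< P a.2 >]) w & g = wordmx w \/ g = - wordmx w].
Proof.
pose ok w := reduced w && all (fun a : letter => `[< P a.2 >]) w.
pose Q g := forall w, ok w -> exists2 w', ok w' &
  g *m wordmx w = wordmx w' \/ g *m wordmx w = - wordmx w'.
have QN h : Q h -> Q (- h).
  by move=> Qh w /Qh[w' ? h']; exists w' => //; rewrite mulNmx;
    case: h' => ->; [right|left]; rewrite ?opprK.
have QM h k : Q h -> Q k -> Q (h *m k).
  move=> Qh Qk w /Qk[w' /Qh[w2 ok2 h2] h']; exists w2 => //.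
  rewrite -mulmxA; case: h' => ->; case: h2; rewrite ?mulmxN => ->;
    rewrite ?opprK; by [left|right].
have Q1 : Q 1%:M by move=> w ow; exists w => //; left; rewrite mul1mx.
have Qg a : P a.2 -> Q (letmx a).
  move=> Pa [|b w]; first by exists [:: a]; [rewrite /ok /=; case: asboolP|left].
  rewrite /ok /= => /andP[rw /andP[Pb Pw]].
  have [ba|ba] := eqVneq b (lopp a).
    exists w; first by rewrite Pw andbT; exact: path_sorted rw.
    by right; rewrite mulmxA ba letmx_opp mulNmx mul1mx.
  exists [:: a, b & w]; last by left.
  by rewrite /= ba rw Pb Pw /= !andbT; exact/asboolP.
(* [Q] of an element says nothing about its inverse, so the induction carries both. *)
suff Qgen h : gen (gens P) h -> Q h /\ Q (invmx h).
  move=> /Qgen[/(_ [::] isT)[w /andP[rw Pw]]]; rewrite mulmx1 => gw _.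
  by exists w.
have genu k : gen (gens P) k -> k \in unitmx.
  by move=> /(gen_det (@gens_det P)) d; rewrite unitmxE d unitr1.
elim=> [||k [a Pa <-]|k l gk [Qk Qk'] gl [Ql Ql']|k _ [Qk Qk']].
- by rewrite invmx1.
- split; first exact: QN.
  by rewrite -raddfN invmx_scalar invrN invr1 raddfN; exact: QN.
- by split; [exact: Qg|rewrite invmx_letmx; apply: QN; exact: Qg].
- split; first exact: QM.
  suff -> : invmx (k *m l) = invmx l *m invmx k by exact: QM.
  have ukl : k *m l \in unitmx by rewrite unitmx_mul !genu.
  apply: (can_inj (mulKmx ukl)); rewrite mulmxV // -mulmxA (mulmxA l).
  by rewrite mulmxV ?genu // mul1mx mulmxV ?genu.
- by split; rewrite ?invmxK.
Qed.

End Words.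

(** * The group: discreteness, absence of torsion, infinite generation *)

Section Group.
Variable R : realType.

Lemma letmx_int (a : letter) : exists q : int,
  letmx R a = mx2 (lint a)%:~R (4 * q)%:~R 1 (lint a)%:~R.
Proof.
(* With t = 4^(n+1), (4t + 1)^2 - 1 = 4 (4t^2 + 2t). *)
exists (4 * (4 ^+ a.2.+1) ^+ 2 + 2 * 4 ^+ a.2.+1).
rewrite /letmx /lval; congr (mx2 _ _ _ _).
rewrite -rmorphXn /= -[X in _ - X]/(1%:~R) -intrB; congr (_%:~R).
by rewrite /lint exprMn -exprM muln2 -addnn exprD -expr2 sqrr_sign mul1r (exprS _ a.2.+1); ring.
Qed.

(** Being integral and lower triangular mod 4 is stable under products; inverses need no separate
    treatment, because [g] is a word up to sign. *)
Lemma gen_int P (g : 'M[R]_2) : gen (gens P) g -> exists p q r s : int,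
  g = mx2 p%:~R (4 * q)%:~R r%:~R s%:~R /\ p * s - 4 * q * r = 1.
Proof.
move=> Pg; have dg := gen_det (@gens_det R P) Pg.
suff [p [q [r [s gE]]]] : exists p q r s : int,
    g = mx2 p%:~R (4 * q)%:~R r%:~R s%:~R.
  exists p, q, r, s; split => //; apply: (@intr_inj R).
  by move: dg; rewrite gE det_mx2 !mx2E -!intrM -intrB.
have [w [_ _ gw]] := gen_reduced Pg.
suff [p [q [r [s wE]]]] : exists p q r s : int,
    wordmx R w = mx2 p%:~R (4 * q)%:~R r%:~R s%:~R.
  case: gw => ->; first by exists p, q, r, s.
  exists (- p), (- q), (- r), (- s); rewrite wE.
  by apply: mx2P; rewrite mxE !mx2E ?mulrN ?rmorphN.
elim: w {gw} => [|a w [p [q [r [s IH]]]]].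
  by exists 1, 0, 0, 1; apply: mx2P; rewrite mxE !mx2E /= ?mulr0.
have [b bE] := letmx_int a.
exists (lint a * p + 4 * b * r), (lint a * q + b * s), (p + lint a * r),
  (4 * q + lint a * s).
rewrite [wordmx _ _]/= IH bE; apply: mx2P;
  by rewrite mulmx2E !mx2E ?(intrD, intrM); ring.
Qed.

Definition grp : set 'M[R]_2 := gen (gens setT).

Lemma grp_Fuchsian : Fuchsian grp.
Proof.
split; first split.
- by move=> g; apply: gen_det; exact: gens_det.
- exact: gen_one.
- exact: gen_neg.
- exact: gen_mul.
- exact: gen_inv.
move=> g /gen_int[p [q [r [s [-> _]]]]]; exists 1; first exact: ltr01.
move=> h /gen_int[p' [q' [r' [s' [-> _]]]]] near.
have intE (m n : int) : `|m%:~R - n%:~R| < 1 :> R -> m%:~R = n%:~R :> R.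
  by rewrite -intrB -intr_norm -[1]/(1%:~R) ltr_int => ?; congr (_%:~R); lia.
by apply: mx2P; rewrite !mx2E; apply: intE;
  [have := near i0 i0|have := near i0 i1|have := near i1 i0|have := near i1 i1];
  rewrite !mx2E.
Qed.

(* Since b = 0 mod 4 and ad = 1 mod 4, the trace a + d is 2 mod 4. *)
Lemma grp_torsion_free : torsion_free grp.
Proof.
move=> g Gg n n0; apply: trace_ge2_torsion_free n0; first exact: gen_det (@gens_det R _) Gg.
have [p [q [r [s [-> d]]]]] := gen_int Gg.
rewrite !mx2E -intrD -intr_norm -[2]/(2%:~R) ler_int.
have [j pj] : exists j, p = 2 * j \/ p = 2 * j + 1 by exists (p %/ 2)%Z; lia.
case: (leP 2 `|p + s|) => // small.
(* Trace 0 would give p^2 = -1 mod 4; trace 1 or -1 would make p s even, whereas p s = 1 + 4 q r is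
   odd. *)
have [ps|[ps|ps]] : s = - p \/ s = 1 - p \/ s = - 1 - p by lia.
all: by exfalso; subst s; case: pj => ?; subst p; lia.
Qed.

Lemma gen_mono (S S' : set 'M[R]_2) : S `<=` S' -> gen S `<=` gen S'.
Proof.
move=> SS' g; elim=> [||h Sh|h k _ ? _ ?|h _ ?].
- exact: gen_one.
- exact: gen_neg.
- by apply: gen_base; exact: SS'.
- exact: gen_mul.
- exact: gen_inv.
Qed.

Lemma gen_sub (S S' : set 'M[R]_2) : S `<=` gen S' -> gen S `<=` gen S'.
Proof.
move=> SS' g; elim=> [||h Sh|h k _ ? _ ?|h _ ?].
- exact: gen_one.
- exact: gen_neg.
- exact: SS'.
- exact: gen_mul.
- exact: gen_inv.
Qed.

(** Turns a finite generating set into a bound on the letters it uses. *)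
Lemma grp_bounded g : grp g -> exists N, gen (gens [set n | (n < N)%N]) g.
Proof.
have mono M N : (M <= N)%N ->
    gen (gens [set n | (n < M)%N]) `<=` gen (@gens R [set n | (n < N)%N]).
  by move=> MN; apply: gen_mono => _ [a /= aM <-]; exists a => //=; exact: leq_trans MN.
elim=> [||h [a _ <-]|h k _ [M hM] _ [N kN]|h _ [N hN]].
- by exists 0; exact: gen_one.
- by exists 0; exact: gen_neg.
- by exists a.2.+1; apply: gen_base; exists a => /=.
- exists (maxn M N); apply: gen_mul; [apply: mono hM|apply: mono kN].
    exact: leq_maxl.
  exact: leq_maxr.
- by exists N; exact: gen_inv.
Qed.

(* A reduced word sends infinity close to its first letter, so a generator lies
   in no subgroup generated by others. *)
Lemma grp_infinitely_generated : infinitely_generated grp.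
Proof.
move=> [s [sG Gs]].
have [N sN] : exists N, {subset s <= [set g | gen (gens [set n | (n < N)%N]) g]}.
  elim: s sG {Gs} => [_|g s IH sG]; first by exists 0.
  have [|N sN] := IH; first by move=> h hs; apply: sG; rewrite in_cons hs orbT.
  have [M gM] := grp_bounded (sG g (mem_head _ _)).
  exists (maxn M N) => h; rewrite in_cons inE => /orP[/eqP ->|/sN]; rewrite ?inE /=.
    apply: gen_mono gM => _ [a /= aM <-]; exists a => //=.
    by rewrite (leq_trans aM) // leq_maxl.
  move=> hN; apply: gen_mono hN => _ [a /= aN <-]; exists a => //=.
  by rewrite (leq_trans aN) // leq_maxr.
have : gen (gens [set n | (n < N)%N]) (letmx R (true, N)).
  have /Gs : grp (letmx R (true, N)) by apply: gen_base; exists (true, N).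
  by apply: gen_sub => g /= /sN; rewrite inE.
move=> /gen_reduced[[|a w] [rw + gw]].
  by case: gw => /matrixP/(_ i1 i0) /eqP; rewrite /= !mxE /= ?mulr0n ?oppr0 oner_eq0.
move=> /andP[/asboolP /= aN _].
have [q0 pq] := wordmx_endv R rw; have near := endv_near R rw.
(* Both sides are the image of oo under the same element. The word starts with a letter of index
   below [N], so its image of oo lies near another value. *)
have e : endv R (a :: w) = lval R (true, N).
  apply: (mulIf q0); rewrite -pq; case: gw => gw.
    by rewrite -gw !mx2E mulr1.
  rewrite (_ : wordmx R (a :: w) = - letmx R (true, N)); last by rewrite gw opprK.
  by rewrite mxE [X in _ = _ * X]mxE !mx2E mulrN mulr1.
have : `|lval R (true, N) - lval R a| < 3 by rewrite -e; lra.
by move=> /lval_sep ea; move: aN; rewrite -ea /= ltnn.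
Qed.

End Group.

(** * Hyperbolic distance, isometries and geodesic rays *)

Section Hyperbolic.
Variable R : realType.
Implicit Types (g : 'M[R]_2) (p q o : R * R).

Definition cosh_dist p q : R :=
  1 + ((p.1 - q.1) ^+ 2 + (p.2 - q.2) ^+ 2) / (2 * p.2 * q.2).

Lemma hdistE p q :
  hdist p q = ln (cosh_dist p q + Num.sqrt (cosh_dist p q ^+ 2 - 1)).
Proof. by []. Qed.

(** This is |c z + d|^2 at z = [p]. *)
Definition mob_den g p := (g i1 i0 * p.1 + g i1 i1) ^+ 2 + (g i1 i0 * p.2) ^+ 2.

Lemma mob_den_gt0 g p : \det g = 1 -> hplane p -> 0 < mob_den g p.
Proof.
rewrite det_mx2 /hplane /= /mob_den => dg p0.
have [c0|c0] := eqVneq (g i1 i0) 0.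
  have d0 : g i1 i1 != 0.
    by apply: contra_eq_neq dg => ->; rewrite c0 !mulr0 subr0 eq_sym oner_neq0.
  by rewrite c0 !mul0r add0r expr0n addr0 exprn_even_gt0.
by rewrite ltr_wpDl ?sqr_ge0 // exprn_even_gt0 //= mulf_neq0 // gt_eqF.
Qed.

Lemma mob_hplane g p : \det g = 1 -> hplane p -> hplane (mob g p).
Proof. by move=> dg p0; rewrite /hplane /= divr_gt0 // mob_den_gt0. Qed.

Lemma mobN g p : mob (- g) p = mob g p.
Proof.
by rewrite /mob !mxE; congr pair; congr (_ / _); ring.
Qed.

Lemma hdist_mob g p q : \det g = 1 -> hplane p -> hplane q ->
  hdist (mob g p) (mob g q) = hdist p q.
Proof.
move=> dg hp hq; rewrite !hdistE (_ : cosh_dist (mob g p) _ = cosh_dist p q) //.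
rewrite /cosh_dist; congr (1 + _).
have /lt0r_neq0 := mob_den_gt0 dg hp; have /lt0r_neq0 := mob_den_gt0 dg hq.
move: hp hq dg; rewrite /hplane /= => /lt0r_neq0 hp /lt0r_neq0 hq; rewrite det_mx2 /mob_den /mob /=.
move: (g i0 i0) (g i0 i1) (g i1 i0) (g i1 i1) p q hp hq => a b c d [x y] [x' y'] /= y0 y0'.
set D := _ + (c * y) ^+ 2; set D' := _ + (c * y') ^+ 2 => dg D0' D0.
(* Inserting powers of the determinant homogenizes the claim into a rational identity in free a, b,
   c, d. *)
have -> : y / D = (a * d - b * c) * y / D by rewrite dg mul1r.
have -> : y' / D' = (a * d - b * c) * y' / D' by rewrite dg mul1r.
have -> : 2 * ((a * d - b * c) * y / D) * ((a * d - b * c) * y' / D') =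
  2 * y / D * (y' / D') by rewrite dg !mul1r !mulrA.
have n2 : (2 : R) != 0 by lra.
have -> : (x - x') ^+ 2 + (y - y') ^+ 2 =
   (a * d - b * c) ^+ 2 * ((x - x') ^+ 2 + (y - y') ^+ 2) by rewrite dg expr1n mul1r.
by rewrite /D /D'; field; rewrite -/D -/D' ?n2 y0 y0' D0 D0'.
Qed.

Lemma hdist_vertical (x a s t : R) : 0 < a ->
  hdist (x, a * expR s) (x, a * expR t) = `|s - t|.
Proof.
move=> a0; rewrite hdistE /cosh_dist /=.
have es := expR_gt0 s; have et := expR_gt0 t.
set X := expR `|s - t|; have X1 : 1 <= X by rewrite -expR0 ler_expR.
have X0 : 0 < X by lra.
have iX : 0 < X^-1 <= 1 by rewrite invr_gt0 X0 invf_le1.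
(* cosh |s - t| in terms of X = exp |s - t|; the arcosh formula then returns X. *)
have uE : 1 + ((x - x) ^+ 2 + (a * expR s - a * expR t) ^+ 2) /
    (2 * (a * expR s) * (a * expR t)) = (X + X^-1) / 2.
  have n2 : (2 : R) != 0 by lra.
  have nes := lt0r_neq0 es; have net := lt0r_neq0 et; have na := lt0r_neq0 a0.
  rewrite /X; case: (lerP t s) => st.
    rewrite expRD expRN.
    by field; rewrite ?n2 na nes net.
  rewrite expRD expRN.
  by field; rewrite ?n2 na nes net.
rewrite uE (_ : _ - 1 = ((X - X^-1) / 2) ^+ 2); last first.
  by field; rewrite lt0r_neq0 //; lra.
rewrite sqrtr_sqr ger0_norm; last by lra.
by rewrite (_ : _ + _ = X); [rewrite expRK|field; rewrite lt0r_neq0 //; lra].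
Qed.

Definition to_infty (x : R) : 'M[R]_2 := mx2 x (- 1) 1 0.

(* The image under z |-> x - 1/z of a vertical ray with real part b. *)
Lemma geodesic_ray_exists o x : hplane o -> exists a b, 0 < a /\
  geodesic_ray o x (fun t => mob (to_infty x) (b, a * expR t)).
Proof.
case: o => o1 o2 /= o20; rewrite /hplane /= in o20.
(* The starting point of the vertical ray is the preimage 1/(x - o) of [o], with denominator n = |o
   - x|^2. *)
pose n := (o1 - x) ^+ 2 + o2 ^+ 2.
have n0 : 0 < n by rewrite /n ltr_wpDl ?sqr_ge0 // exprn_gt0.
have d1 : \det (to_infty x) = 1 by rewrite det_mx2 !mx2E; ring.
have a0 : 0 < o2 / n by rewrite divr_gt0.
have hp t : hplane ((x - o1) / n, o2 / n * expR t).
  by rewrite /hplane /= mulr_gt0 ?expR_gt0.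
exists (o2 / n), ((x - o1) / n); split=> //; split.
- rewrite expR0 mulr1 /mob !mx2E /=.
  set D := (_ ^+ 2 + _).
  have DE : D = n^-1.
    by rewrite /D /n; field; rewrite -/n lt0r_neq0.
  rewrite DE invrK; congr pair.
    by rewrite /n; field; rewrite -/n lt0r_neq0.
  by field; rewrite lt0r_neq0.
- by move=> t _; apply: mob_hplane.
- by move=> s t _ _; rewrite hdist_mob // hdist_vertical.
move: (o2 / n) ((x - o1) / n) a0 {hp} => a b a0 e e0.
(* At height aE the horizontal error is at most |b|/(a^2 E) and the height of the image at most
   1/(aE); each summand handles one of them. *)
pose M := (`|b| + 1) / (a ^+ 2 * e) + 1 / (a * e).
exists (M + 1) => t Mt.
have a20 : 0 < a ^+ 2 by rewrite exprn_gt0.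
have M0 : 0 <= M.
  by apply: addr_ge0; apply: divr_ge0; rewrite ?addr_ge0 // mulr_ge0 // ltW.
have E1 : 1 <= expR t by rewrite -expR0 ler_expR; lra.
have tE : M < expR t by have := expR_ge1Dx t; lra.
set E := expR t in E1 tE *.
have aE0 : 0 < a * E by rewrite mulr_gt0 //; lra.
have nE2 : a ^+ 2 * E <= b ^+ 2 + (a * E) ^+ 2.
  have E2 : E <= E ^+ 2 by rewrite expr2 ler_peMr //; lra.
  apply: (@le_trans _ _ ((a * E) ^+ 2)); last by rewrite lerDr sqr_ge0.
  by rewrite exprMn ler_pM2l.
have D0 : 0 < b ^+ 2 + (a * E) ^+ 2 by apply: lt_le_trans nE2; rewrite mulr_gt0 //; lra.
have MbE : (`|b| + 1) / (a ^+ 2 * e) < E.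
  by apply: le_lt_trans tE; rewrite lerDl divr_ge0 // mulr_ge0 // ltW.
have MaE : 1 / (a * e) < E.
  apply: le_lt_trans tE; rewrite lerDr divr_ge0 // ?addr_ge0 //.
  by rewrite mulr_ge0 // ltW.
rewrite /mob !mx2E /=; split.
  rewrite (_ : _ / _ - x = - b / (b ^+ 2 + (a * E) ^+ 2)); last first.
    rewrite mul1r addr0 mul1r mulr1; field; exact: lt0r_neq0.
  rewrite normrM normrN normfV (gtr0_norm D0) ltr_pdivrMr //.
  move: MbE; rewrite ltr_pdivrMr ?mulr_gt0 // => MbE.
  have := ler_wpM2l (ltW e0) nE2; lra.
rewrite !mul1r addr0 ltr_pdivrMr //.
move: MaE; rewrite ltr_pdivrMr ?mulr_gt0 // => MaE.
have : 1 * (a * E) < E * (a * e) * (a * E) by rewrite ltr_pM2r.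
rewrite mul1r => h; apply: lt_le_trans h _.
rewrite mulrDr (_ : e * (a * E) ^+ 2 = E * (a * e) * (a * E)); last by ring.
by rewrite lerDr mulr_ge0 ?sqr_ge0 // ltW.
Qed.

Lemma hdist_le o p (U : R) :
  cosh_dist p o <= U -> hplane p -> hplane o -> hdist p o <= ln (2 * U).
Proof.
rewrite /hplane hdistE /= => uU p0 o0; set u := cosh_dist p o in uU *.
have u1 : 1 <= u by rewrite lerDl divr_ge0 ?addr_ge0 ?sqr_ge0 // !mulr_ge0 // ltW.
have su : Num.sqrt (u ^+ 2 - 1) <= u.
  by rewrite -[leRHS]ger0_norm ?(le_trans ler01) // -sqrtr_sqr ler_wsqrtr // gerBl.
have := sqrtr_ge0 (u ^+ 2 - 1).
move: (Num.sqrt _) su => v vu v0.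
by rewrite ler_ln ?posrE; lra.
Qed.

End Hyperbolic.

(** * Coding of limit points by reduced words *)

Section Coding.
Variable R : realType.
Local Notation G := (@grp R).

(** Closure of the images of oo under nonempty reduced words; unlike orbit points of [o], these
    reveal their first letter through [endv_near]. *)
Definition end_limit (x : R) := forall e, 0 < e -> exists a w,
  reduced (a :: w) /\ `|endv R (a :: w) - x| < e.

Lemma grp_c_ge1 (g : 'M[R]_2) : G g -> g i1 i0 != 0 -> 1 <= `|g i1 i0|.
Proof.
move=> /gen_int[p [q [r [s [-> _]]]]]; rewrite !mx2E intr_eq0 -intr_norm.
by rewrite -[1]/(1%:~R) ler_int -gtz0_ge1 normr_gt0.
Qed.

(* Re (g o) differs from g(oo) by at most the square root of Im (g o) / Im o. *)
Lemma limit_point_end (o : R * R) x : hplane o -> Defs.limit_point G o x -> end_limit x.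
Proof.
move=> o0 Lx e e0; rewrite /hplane /= in o0.
(* The second bound yields 1/D < e^2/4 for D = |c o + d|^2; the third, Im (g o) < Im o, excludes the
   empty word. *)
have [|g Gg [gx gy]] := Lx (Num.min (e / 2) (Num.min (o.2 * (e ^+ 2 / 4)) o.2)).
  by rewrite !lt_min divr_gt0 //= o0 andbT mulr_gt0 // divr_gt0 // exprn_gt0.
move: gx gy; rewrite !lt_min => /andP[gx _] /andP[_ /andP[gy gy']].
have [w [rw _ gw]] := gen_reduced Gg.
have gwE : mob g o = mob (wordmx R w) o by case: gw => ->; rewrite ?mobN.
rewrite gwE in gx gy gy'; case: w rw {gw gwE g Gg} gx gy gy' => [|a w] rw.
  rewrite /mob /= !mxE /= !mulr0n !mulr1n !(mul0r, mul1r, add0r, addr0).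
  by rewrite expr0n expr1n addr0 !divr1 ltxx.
move=> gx gy _; exists a, w; split => //.
have [c0 acE] := wordmx_endv R rw.
have Gw : G (wordmx R (a :: w)) by apply: gen_wordmx; apply/allP => b _; exact/asboolP.
have c1 := grp_c_ge1 Gw c0.
have dw := det_wordmx R (a :: w).
have D0 := mob_den_gt0 dw o0.
move: (endv R (a :: w)) acE gx gy c0 c1 dw D0; move: (wordmx R (a :: w)) => W v.
rewrite det_mx2 /mob /mob_den /=; set c := W i1 i0; set d := W i1 i1 => ->.
set k := c * o.1 + d; set D := k ^+ 2 + _ => gx gy c0 c1 dw D0.
have bE : W i0 i1 = v * d - 1 / c by apply: (mulIf c0); rewrite mulrBl divfK // -dw; ring.
(* Re (g o) - g(oo) = -k/(cD), where k^2 <= D and |c| >= 1, so its modulus is at most D^(-1/2). *)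
have diffE : (((v * c) * o.1 + W i0 i1) * k + v * c * c * o.2 ^+ 2) / D - v = - (k / (c * D)).
  rewrite bE /D /k; by field; rewrite -/k -/D c0 lt0r_neq0.
have De : 1 / D < e ^+ 2 / 4.
  by move: gy; rewrite ltr_pdivrMr // -(mulrA o.2) -[X in X < _]mulr1 ltr_pM2l // ltr_pdivrMr.
have kD : `|k / (c * D)| < e / 2.
  rewrite -(@ltr_pXn2r _ 2) ?nnegrE ?divr_ge0 // ?ltW //.
  rewrite -normrX ger0_norm ?sqr_ge0 // !expr_div_n (_ : 2 ^+ 2 = 4); last by ring.
  apply: le_lt_trans De; rewrite exprMn.
  have c2 : 1 <= c ^+ 2 by rewrite -real_normK ?num_real // exprn_ege1.
  have kD2 : k ^+ 2 <= D by rewrite lerDl sqr_ge0.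
  have c20 : 0 < c ^+ 2 by lra.
  rewrite ler_pdivrMr; last by rewrite mulr_gt0 // exprn_gt0.
  rewrite (_ : 1 / D * (c ^+ 2 * D ^+ 2) = c ^+ 2 * D); last first.
    by field; exact: lt0r_neq0.
  by apply: le_trans kD2 _; rewrite ler_peMl // ltW.
have -> : v - x = (((v * c) * o.1 + W i0 i1) * k + v * c * c * o.2 ^+ 2) / D - x
    - ((((v * c) * o.1 + W i0 i1) * k + v * c * c * o.2 ^+ 2) / D - v) by ring.
by apply: le_lt_trans (ler_normB _ _) _; rewrite diffE normrN; lra.
Qed.

Lemma end_limit_letter x : end_limit x -> exists a, `|x - lval R a| <= 1 / 2.
Proof.
move=> /(_ (1 / 4)) [|a [w [rw h]]]; first by lra.
exists a; have := endv_near R rw => h'.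
have := ler_normB (endv R (a :: w) - lval R a) (endv R (a :: w) - x).
by rewrite (_ : _ - _ - _ = x - lval R a); [lra|ring].
Qed.

(** Reduced words ending close to [x] start with [a], and have a second letter since [x] is not
    [lval a]. Deleting [a] applies [psi a], which has Lipschitz constant at most 2/r^2 near [x]. *)
Lemma end_limit_psi x a : end_limit x -> `|x - lval R a| <= 1 / 2 ->
  x != lval R a -> end_limit (psi a x).
Proof.
move=> Lx xa xna e e0; set r := `|x - lval R a| in xa.
have r0 : 0 < r by rewrite normr_gt0 subr_eq0.
have [|b [w [rw h]]] := Lx (Num.min (1 / 4) (Num.min (r / 2) (e * (r ^+ 2 / 2)))).
  by rewrite !lt_min !divr_gt0 //= mulr_gt0 // divr_gt0 // exprn_gt0.
move: h; rewrite !lt_min => /andP[h1 /andP[h2 h3]].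
have ba : b = a.
  apply: (@lval_sep R); have := endv_near R rw => h'.
  have := ler_normB (endv R (b :: w) - x) (endv R (b :: w) - lval R b).
  have := ler_normD (lval R b - x) (x - lval R a).
  rewrite (_ : _ - _ + _ = lval R b - lval R a); last by ring.
  rewrite (_ : _ - _ - _ = lval R b - x); last by ring.
  by rewrite -/r; lra.
subst b; case: w rw h1 h2 h3 => [|b w] rw h1 h2 h3.
  by move: h2; rewrite /= distrC -/r; lra.
exists b, w; split; first exact: path_sorted rw.
have evE : endv R [:: a, b & w] = phi a (endv R (b :: w)) by [].
rewrite -[endv R (b :: w)](phiK a) -evE.
move: (endv R [:: a, b & w]) h1 h2 h3 => y h1 h2 h3.
have yr : r / 2 < `|y - lval R a|.
  have := ler_normB (y - lval R a) (y - x).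
  by rewrite (_ : _ - _ - _ = x - lval R a); [rewrite -/r; lra|ring].
have y0 : y - lval R a != 0 by rewrite -normr_gt0; lra.
have x0 : x - lval R a != 0 by rewrite subr_eq0.
rewrite (_ : _ - _ = (y - x) / ((y - lval R a) * (x - lval R a))); last first.
  by rewrite /psi; field; rewrite x0 y0.
rewrite normrM normfV normrM -/r ltr_pdivrMr ?mulr_gt0 //; last by lra.
apply: lt_le_trans h3 _; rewrite ler_pM2l // (_ : r ^+ 2 / 2 = r / 2 * r); last by ring.
by rewrite ler_pM2r // ltW.
Qed.

(* The default of xget is irrelevant: nu is only used on end limits. *)
Definition nu (x : R) : letter := xget (false, 0%N) [set a | `|x - lval R a| <= 1 / 2].
Definition shift (x : R) : R := psi (nu x) x.

(** The inequality says that the code of [x] does not stop here: the true shift of [lval (nu x)]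
    would be oo. *)
Definition coded (x : R) := end_limit x /\ x != lval R (nu x).

Lemma nuP x : end_limit x -> `|x - lval R (nu x)| <= 1 / 2.
Proof. by move=> /end_limit_letter[a ha]; rewrite /nu; case: xgetP => [? _ //|/(_ a)]. Qed.

Lemma phi_shift x : phi (nu x) (shift x) = x.
Proof. exact: psiK. Qed.

Lemma coded_end_limit x : coded x -> end_limit (shift x).
Proof. by case=> Lx xn; apply: end_limit_psi => //; exact: nuP. Qed.

Lemma coded_ge2 x : coded x -> 2 <= `|shift x + lval R (nu x)|.
Proof.
move=> [/nuP h xn]; rewrite /shift psi_addE normrN normfV.
have r0 : 0 < `|x - lval R (nu x)| by rewrite normr_gt0 subr_eq0.
by rewrite -[2]invrK lef_pV2 ?posrE ?invr_gt0 //; lra.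
Qed.

(** Codes are reduced: if [lopp (nu x)] came next, the right-hand side would be at most 1/2, against
    [coded_ge2]. Hence [lval_far] applies. *)
Lemma coded_far x : coded x -> 8 * 4 ^+ (nu x).2 <= `|shift x + lval R (nu x)|.
Proof.
move=> cx; have h := nuP (coded_end_limit cx); apply: (lval_far _ h).
apply/eqP => e; have := coded_ge2 cx; move: h.
by rewrite e lval_opp opprK; lra.
Qed.

(** Here [g] is the product of the first [k] letters, and c y + d, for y the k-th shift, is the
    product of the [k] denominators, each of modulus at least 2. The bound on c later keeps m of
    [mob_ray] bounded. *)
Lemma coded_word x k : (forall j, (j < k)%N -> coded (iter j shift x)) ->
  exists g, [/\ G g, x * (g i1 i0 * iter k shift x + g i1 i1) =
                     g i0 i0 * iter k shift x + g i0 i1,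
                2 ^+ k <= `|g i1 i0 * iter k shift x + g i1 i1| &
                `|g i1 i0| <= `|g i1 i0 * iter k shift x + g i1 i1|].
Proof.
elim: k => [_|k IH ck].
  exists 1%:M; split; rewrite ?mxE /= ?mul0r ?add0r ?normr1 ?normr0 //.
  - exact: gen_one.
  - by rewrite mulr1 mul1r addr0.
have [|g [Gg eqx J2 cJ]] := IH; first by move=> j jk; apply: ck; exact: ltnW.
have := ck k (ltnSn k); rewrite iterS; move: (iter k shift x) eqx J2 cJ => y eqx J2 cJ cy.
have := coded_ge2 cy; have yE := phi_shift y.
set z := shift y in yE *; set a := nu y in yE *; set f := z + lval R a => f2.
have f0 : f != 0 by rewrite -normr_gt0; lra.
have {}yE : y = lval R a - f^-1 by rewrite -yE.
have zE : z = f - lval R a by rewrite /f addrK.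
clearbody f; rewrite zE.
exists (g *m letmx R a); rewrite !mulmx2E !mx2E.
have -> : (g i1 i0 * lval R a + g i1 i1 * 1) * (f - lval R a) +
    (g i1 i0 * (lval R a ^+ 2 - 1) + g i1 i1 * lval R a) = f * (g i1 i0 * y + g i1 i1).
  by rewrite yE; field.
have -> : (g i0 i0 * lval R a + g i0 i1 * 1) * (f - lval R a) +
    (g i0 i0 * (lval R a ^+ 2 - 1) + g i0 i1 * lval R a) = f * (g i0 i0 * y + g i0 i1).
  by rewrite yE; field.
have J0 : 0 <= `|g i1 i0 * y + g i1 i1| by [].
split.
- by apply: gen_mul => //; apply: gen_base; exists a.
- by rewrite mulrCA eqx.
- rewrite normrM exprS; apply: ler_pM => //; exact: exprn_ge0.
(* With J = c y + d the new lower left entry is J + c/f, of modulus at most 2|J| <= |f J|. *)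
- have -> : g i1 i0 * lval R a + g i1 i1 * 1 = (g i1 i0 * y + g i1 i1) + g i1 i0 / f.
    by rewrite yE; field.
  rewrite normrM; apply: le_trans (ler_normD _ _) _; rewrite normrM normfV.
  have : `|g i1 i0| / `|f| <= `|g i1 i0 * y + g i1 i1|.
    rewrite ler_pdivrMr; last by lra.
    by apply: le_trans cJ _; rewrite ler_peMr //; lra.
  have : 2 * `|g i1 i0 * y + g i1 i1| <= `|f| * `|g i1 i0 * y + g i1 i1|.
    by rewrite ler_wpM2r.
  lra.
Qed.

(* With J = c y + d, the point y - 1/(i + m), m = b/J^2 + c/J, which stays in a
   compact region, is mapped by g to the point of height parameter J^2 on the ray
   towards x = g y. *)
Lemma mob_ray (g : 'M[R]_2) x y b (J := g i1 i0 * y + g i1 i1)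
    (m := b / J ^+ 2 + g i1 i0 / J) : \det g = 1 -> J != 0 ->
  x * J = g i0 i0 * y + g i0 i1 ->
  mob g (y - m / (1 + m ^+ 2), 1 / (1 + m ^+ 2)) = mob (to_infty x) (b, J ^+ 2).
Proof.
rewrite det_mx2 => dg J0 xJ.
have dE : g i1 i1 = J - g i1 i0 * y by rewrite /J; ring.
have aE : g i0 i0 = 1 / J + g i1 i0 * x.
  apply: (mulIf J0); rewrite mulrDl divfK // -mulrA xJ -dg dE; ring.
have bE : g i0 i1 = x * J - g i0 i0 * y by rewrite xJ; ring.
rewrite /mob bE aE dE !mx2E /=.
rewrite {dg xJ dE aE bE} /m {m}; clearbody J; move: (g i1 i0) => c.
have m0 : 1 + (b / J ^+ 2 + c / J) ^+ 2 != 0 by rewrite lt0r_neq0 // ltr_pwDl ?sqr_ge0.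
have D0 : b ^+ 2 + J ^+ 2 ^+ 2 != 0.
  apply/lt0r_neq0/ltr_wpDl; first exact: sqr_ge0.
  by rewrite exprn_gt0 // exprn_even_gt0.
move: m0; set m := b / J ^+ 2 + c / J => m0.
have bm : b = (m - c / J) * J ^+ 2 by rewrite /m; field.
clearbody m.
have EE : (c * (y - m / (1 + m ^+ 2)) + (J - c * y)) ^+ 2 +
    (c * (1 / (1 + m ^+ 2))) ^+ 2 =
    (b ^+ 2 + J ^+ 2 ^+ 2) / (J ^+ 2 * (1 + m ^+ 2)).
  by rewrite bm; field; rewrite J0 m0.
have bJ : b = (m * J - c) * J by rewrite bm; field.
by rewrite {}EE; congr pair; rewrite bJ; field; rewrite J0 m0 -bJ D0.
Qed.

End Coding.

(** * Recurrence along codes with infinitely many bounded letters *)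

Section NotTransient.
Variable R : realType.

(** Whenever the i-th letter is bounded, [mob_ray] exhibits a point of the ray as the image under
    [g] of a point of a fixed compact region. As |J| >= 2^i, this happens at arbitrarily late
    times. *)
Lemma recurrent_not_transient (x : R) (o : R * R) N : hplane o ->
  (forall i, coded (iter i (@shift R) x)) ->
  (forall k, exists2 i, (k <= i)%N & ((nu (iter i (@shift R) x)).2 < N)%N) ->
  ~ transient_limit_point (@grp R) o x.
Proof.
move=> o0 cx smallx [_ trx].
have [a [b [a0 rayx]]] := geodesic_ray_exists x o0.
(* [B] bounds |m|, [H] bounds |y|, and [U] bounds the cosh of the distance from the compact region
   to [o]. *)
pose B := `|b| + 1; pose H : R := 4 * 4 ^+ N.+1 + 2.
pose U := 1 + ((H + 1 + `|o.1|) ^+ 2 + (1 + o.2) ^+ 2) * (1 + B ^+ 2) / (2 * o.2).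
have [T HT] := trx _ rayx (ln (2 * U) + 1).
have o2 : 0 < o.2 by [].
pose k := Num.bound (a * expR T).
have ak : a * expR T < 2 ^+ k.
  have := archi_boundP (ltW (mulr_gt0 a0 (expR_gt0 T))); rewrite -/k => h.
  apply: lt_le_trans h _; rewrite -natrX ler_nat ltnW //; exact: ltn_expl.
have [i ki iN] := smallx k.
have [g [Gg gx J2 cJ]] := coded_word (fun j (_ : (j < i)%N) => cx j).
move: (iter i _ x) (cx i) iN gx J2 cJ => y [Ly _] yN gx J2 cJ.
set J := g i1 i0 * y + g i1 i1 in gx J2 cJ.
have i1J : 1 <= 2 ^+ i :> R by apply: exprn_ege1; lra.
have J0 : J != 0 by rewrite -normr_gt0; lra.
have dg : \det g = 1 by exact: gen_det (@gens_det R _) Gg.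
pose m := b / J ^+ 2 + g i1 i0 / J.
have JJ : `|J| <= J ^+ 2.
  by rewrite -real_normK ?num_real // expr2 ler_peMr //; lra.
have mB : `|m| <= B.
  apply: le_trans (ler_normD _ _) _; apply: lerD.
    rewrite normrM normfV (ger0_norm (sqr_ge0 J)) ler_pdivrMr; last by lra.
    by rewrite ler_peMr //; lra.
  by rewrite normrM normfV ler_pdivrMr ?mul1r //; lra.
have m2 : m ^+ 2 <= B ^+ 2.
  by rewrite -[m ^+ 2]real_normK ?num_real // lerXn2r ?nnegrE // addr_ge0.
have m1 : 0 < 1 + m ^+ 2 by rewrite ltr_pwDl ?sqr_ge0.
set p := (y - m / (1 + m ^+ 2), 1 / (1 + m ^+ 2)).
have p0 : hplane p by rewrite /hplane /= divr_gt0.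
have yH : `|y| <= H.
  have := nuP Ly => h; have := ler_normD (y - lval R (nu y)) (lval R (nu y)).
  rewrite subrK; have : `|lval R (nu y)| <= 4 * 4 ^+ N.+1 + 1.
    rewrite lvalE normrM normr_sign mul1r ger0_norm; last first.
      by rewrite addr_ge0 // mulr_ge0 // exprn_ge0.
    by rewrite lerD2r ler_pM2l // ler_weXn2l ?ltnS //; [lra|exact: ltnW].
  by rewrite /H; lra.
have pU : cosh_dist p o <= U.
  rewrite /cosh_dist /U lerD2l.
  have mm : `|m / (1 + m ^+ 2)| <= 1.
    rewrite normrM normfV (gtr0_norm m1) ler_pdivrMr // mul1r.
    by rewrite -[m ^+ 2]real_normK ?num_real //; have := sqr_ge0 (`|m| - 1); nra.
  have h1 : (p.1 - o.1) ^+ 2 <= (H + 1 + `|o.1|) ^+ 2.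
    rewrite -[leLHS]real_normK ?num_real // lerXn2r ?nnegrE //.
      by rewrite !addr_ge0 // mulr_ge0 // exprn_ge0.
    apply: le_trans (ler_normB _ _) _; rewrite lerD2r.
    by apply: le_trans (ler_normB _ _) _; rewrite lerD.
  have p21 : p.2 <= 1 by rewrite /p /= ler_pdivrMr // mul1r lerDl sqr_ge0.
  have h2 : (p.2 - o.2) ^+ 2 <= (1 + o.2) ^+ 2.
    rewrite -[leLHS]real_normK ?num_real // lerXn2r ?nnegrE //; first by lra.
    apply: le_trans (ler_normB _ _) _; rewrite (gtr0_norm p0) (gtr0_norm o2).
    by rewrite lerD2r.
  rewrite (_ : 2 * p.2 * o.2 = (2 * o.2) / (1 + m ^+ 2)); last by rewrite /p /=; ring.
  rewrite invfM invrK mulrA [X in _ <= X](_ : _ =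
    (((H + 1 + `|o.1|) ^+ 2 + (1 + o.2) ^+ 2) / (2 * o.2)) * (1 + B ^+ 2)); last by ring.
  apply: ler_pM; rewrite ?lerD2l ?(ltW m1) //.
    by rewrite divr_ge0 ?addr_ge0 ?sqr_ge0 // mulr_ge0 // ltW.
  by rewrite ler_pM2r ?invr_gt0 ?mulr_gt0 // lerD.
(* The time at which the vertical ray reaches height J^2. *)
pose t := ln (J ^+ 2 / a).
have Ja0 : 0 < J ^+ 2 / a by rewrite divr_gt0 // lt_neqAle sqr_ge0 eq_sym sqrf_eq0 J0.
have tE : a * expR t = J ^+ 2.
  by rewrite lnK ?posrE // mulrC divfK // gt_eqF.
have Tt : T <= t.
  rewrite -ler_expR -(ler_pM2l a0) tE; apply: le_trans JJ; apply: le_trans J2.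
  apply: ltW; apply: lt_le_trans ak _; rewrite ler_weXn2l //; lra.
have := HT t Tt g Gg; rewrite tE -(mob_ray b dg J0 gx) hdist_mob //.
have := hdist_le pU p0 o0; rewrite -/p; lra.
Qed.

End NotTransient.

(** * Covers of small s-cost and null sets *)

Section Covers.
Variable R : realType.
Implicit Types (s : R) (A : set R) (c : \bar R).

Definition cov s A c := exists U : nat -> set R, exists r : nat -> R,
  [/\ A `<=` \bigcup_n U n, forall n, 0 <= r n,
      forall n x y, U n x -> U n y -> `|x - y| <= r n &
      (\sum_(n <oo) ((r n) `^ s)%:E <= c)%E].

Lemma cov_le s A B c c' : A `<=` B -> (c <= c')%E -> cov s B c -> cov s A c'.
Proof.
move=> AB cc' [U [r [BU r0 Ur rc]]]; exists U, r; split=> //.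
  exact: subset_trans BU.
exact: le_trans cc'.
Qed.

Lemma cov_bigcup s (A : nat -> set R) (c : nat -> \bar R) :
  (forall i, cov s (A i) (c i)) -> cov s (\bigcup_i A i) (\sum_(i <oo) c i)%E.
Proof.
move=> /choice[U] /choice[r] Ur.
have /card_esym/ppcard_eqP[f] := card_nat2.
pose V n := U (f n).1 (f n).2; pose q n := r (f n).1 (f n).2.
exists V, q; split.
- move=> x [i _]; have [h _ _ _] := Ur i; move=> /h[j _ Ux].
  by exists (f^-1%FUN (i, j)) => //; rewrite /V invK ?inE.
- by move=> n; have [_ h _ _] := Ur (f n).1; exact: h.
- by move=> n; have [_ _ h _] := Ur (f n).1; exact: h.
pose F (ij : nat * nat) := ((r ij.1 ij.2) `^ s)%:E.
have F0 ij : (0 <= F ij)%E by rewrite lee_fin powR_ge0.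
rewrite [leLHS]nneseries_esumT; last by move=> n; rewrite lee_fin powR_ge0.
have fbij := @bij _ _ _ _ f.
rewrite -(reindex_esum [set: nat] [set: nat * nat] f F fbij).
rewrite (_ : setT = setT `*`` (fun=> setT)); last by apply/seteqP; split.
rewrite -(@esum_esum _ _ _ setT (fun=> setT) (fun i j => F (i, j))) //.
rewrite -[leLHS]nneseries_esumT; last by move=> n; exact: esum_ge0.
apply: lee_nneseries => [n _ _|n _]; first exact: esum_ge0.
by rewrite -nneseries_esumT //; have [_ _ _] := Ur n.
Qed.

Lemma cov_diam s A r : 0 < s -> 0 <= r ->
  (forall x y, A x -> A y -> `|x - y| <= r) -> cov s A (r `^ s)%:E.
Proof.
move=> s0 r0 Ar.
(* The padding by empty sets of radius 0 is free because 0^s = 0 for s > 0. *)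
exists (fun n => if n == 0%N then A else set0), (fun n => if n == 0%N then r else 0).
split.
- by move=> x Ax; exists 0%N.
- by case.
- by case.
rewrite (nneseries_split 0 1); last by move=> k _; rewrite lee_fin powR_ge0.
rewrite add0n big_nat1 eseries0 ?adde0 // => -[//|n] _ _ /=.
by rewrite powR0 ?gt_eqF.
Qed.

Lemma cov_image s A c (f : R -> R) k : 0 <= k ->
  (forall x y, A x -> A y -> `|f x - f y| <= k * `|x - y|) ->
  cov s A c -> cov s (f @` A) ((k `^ s)%:E * c)%E.
Proof.
move=> k0 fk [U [r [AU r0 Ur rc]]].
exists (fun n => f @` (A `&` U n)), (fun n => k * r n); split.
- by move=> _ [x Ax <-]; have [n _ Ux] := AU _ Ax; exists n => //; exists x.
- by move=> n; rewrite mulr_ge0.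
- move=> n _ _ [x [Ax Ux] <-] [y [Ay Uy] <-].
  by apply: le_trans (fk _ _ Ax Ay) _; rewrite ler_wpM2l // (Ur n).
under eq_eseriesr do rewrite powRM // EFinM.
rewrite nneseriesZl; last by move=> n _; rewrite lee_fin powR_ge0.
by rewrite lee_wpmul2l // lee_fin powR_ge0.
Qed.

Definition null s A := forall e : R, 0 < e -> cov s A e%:E.

Lemma null_subset s A B : A `<=` B -> null s B -> null s A.
Proof. by move=> AB nB e /nB; exact: cov_le. Qed.

Lemma null_bigcup s (A : nat -> set R) :
  (forall i, null s (A i)) -> null s (\bigcup_i A i).
Proof.
move=> nA e e0; apply: (cov_le (@subset_refl _ _) (epsilon_trick0 xpredT (ltW e0))).
by apply: cov_bigcup => i; apply: nA; rewrite divr_gt0 // ltr0n expn_gt0.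
Qed.

Lemma null_set1 s (x : R) : 0 < s -> null s [set x].
Proof.
move=> s0 e e0; have : cov s [set x] (0 `^ s)%:E.
  by apply: cov_diam => // _ _ -> ->; rewrite subrr normr0.
by apply: cov_le => //; rewrite powR0 ?gt_eqF // lee_fin ltW.
Qed.

(** The scale in the content takes care of itself: if the total cost is at most d^s, so is each
    term, and every radius is at most d. *)
Lemma null_hausdorff_measure s A : 0 < s -> null s A -> hausdorff_measure s A = 0%E.
Proof.
move=> s0 nA.
have H0 d : 0 < d -> hausdorff_content s d A = 0%E.
  move=> d0; apply/eqP; rewrite eq_le; apply/andP; split; last first.
    by apply: le_ereal_inf_tmp => _ [r _ <-]; apply: nneseries_ge0 => n _ _;
      rewrite lee_fin powR_ge0.
  apply/lee_addgt0Pr => e e0; rewrite add0e.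
  have [|U [r [AU r0 Ur rc]]] := nA (Num.min e (d `^ s)).
    by rewrite lt_min e0 powR_gt0.
  have rce : (\sum_(n <oo) ((r n) `^ s)%:E <= e%:E)%E.
    by apply: le_trans rc _; rewrite lee_fin ge_min lexx.
  apply: le_trans rce; apply: ereal_inf_lbound; exists r => //; exists U; split => // n.
  split => //; last exact: Ur.
  have : ((r n `^ s)%:E <= (d `^ s)%:E)%E.
    apply: (@le_trans _ _ (Num.min e (d `^ s))%:E); last first.
      by rewrite lee_fin ge_min lexx orbT.
    apply: le_trans rc.
    have rn0 k : (0 <= k)%N -> (0 <= ((r k) `^ s)%:E)%E by rewrite lee_fin powR_ge0.
    rewrite (nneseries_split 0 n.+1) // add0n big_nat_recr //= -addeA addeC -addeA.
    rewrite leeDl // adde_ge0 //; last by rewrite sume_ge0 // => ? _; exact: rn0.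
    by apply: nneseries_ge0 => k _ _; exact: rn0.
  rewrite lee_fin; apply: contraTT; rewrite -!ltNge => dr.
  by apply: gt0_ltr_powR => //; rewrite nnegrE // ltW.
rewrite /hausdorff_measure; apply/eqP; rewrite eq_le; apply/andP; split.
  by apply: ge_ereal_sup => _ [d d0 <-]; rewrite H0.
by apply: ereal_sup_ubound; exists 1 => //=; rewrite H0.
Qed.

Lemma null_hausdorff_dim A : (forall s, 0 < s -> null s A) -> hausdorff_dim A = 0%E.
Proof.
move=> nA; apply/eqP; rewrite eq_le; apply/andP; split; last first.
  by apply: le_ereal_inf_tmp => _ [s [s0 _] <-]; rewrite lee_fin.
apply/lee_addgt0Pr => e e0; rewrite add0e; apply: ereal_inf_lbound.
by exists e => //; split; [exact: ltW|apply: null_hausdorff_measure => //; exact: nA].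
Qed.

Lemma geometric_eseries_le (c p : R) : 0 <= c -> 0 <= p -> p < 1 ->
  (\sum_(n <oo) (c * p ^+ n)%:E <= (c / (1 - p))%:E)%E.
Proof.
move=> c0 p0 p1.
apply: lime_le.
  by apply: is_cvg_nneseries => n _ _; rewrite lee_fin mulr_ge0 // exprn_ge0.
apply: nearW => n; rewrite sumEFin lee_fin.
have -> : \sum_(0 <= i < n) c * p ^+ i = series (geometric c p) n by [].
rewrite geometric_seriesE ?lt_eqF //= ler_pM2r ?invr_gt0 ?subr_gt0 //.
by rewrite ler_piMr // gerBl exprn_ge0.
Qed.

End Covers.

Import numFieldNormedType.Exports.

(** * Dimension of the transient limit set *)

Section Dimension.
Variable R : realType.

(** Covers are indexed by [nat], so the two signs are interleaved; 4^index then becomes about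
    2^n. *)
Definition nth_letter (n : nat) : letter := (odd n, n./2).

Lemma nth_letter_surj (a : letter) : exists n, a = nth_letter n.
Proof.
case: a => b n; exists (b + n.*2)%N.
by rewrite /nth_letter oddD odd_double addbF half_bit_double; case: b.
Qed.

Lemma expr2_le_nth_letter n : 2 * 2 ^+ n <= 8 * 4 ^+ (nth_letter n).2 :> R.
Proof.
rewrite -{1}(odd_double_half n) exprD -mul2n exprM /= (_ : 2 ^+ 2 = 4); last by ring.
have := expr4_ge1 R n./2; case: odd; rewrite ?expr1 ?expr0; lra.
Qed.

Definition deep M : set R := [set x | forall i,
  coded (iter i (@shift R) x) /\ (M <= (nu (iter i (@shift R) x)).2)%N].

Lemma deep_shift M x : deep M x -> deep M (shift x).
Proof. by move=> Mx i; rewrite -iterSr; exact: Mx. Qed.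

Definition deep_cyl M n := deep M `&` [set x | nu x = nth_letter n].

Lemma deep_cyl_bigcup M : deep M `<=` \bigcup_n deep_cyl M (n + M).
Proof.
move=> x Mx; have [n xn] := nth_letter_surj (nu x).
have [_ /=] := Mx 0%N; rewrite xn /= => Mn.
(* M <= n./2 implies M <= n; starting at [M] is what puts p^M in front of the later geometric
   series. *)
exists (n - M)%N => //; rewrite /deep_cyl subnK //.
by lia.
Qed.

Lemma deep_cyl_far M n x : deep_cyl M n x ->
  2 * 2 ^+ n <= `|shift x + lval R (nth_letter n)|.
Proof.
move=> [Mx xn]; have [/coded_far] := Mx 0%N; rewrite /= xn => h _.
exact: le_trans (expr2_le_nth_letter n) h.
Qed.

Lemma phi_contract n x y : 2 * 2 ^+ n <= `|x + lval R (nth_letter n)| ->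
  2 * 2 ^+ n <= `|y + lval R (nth_letter n)| ->
  `|phi (nth_letter n) x - phi (nth_letter n) y| <= (1 / 2) ^+ n * `|x - y|.
Proof.
have n1 : 1 <= 2 ^+ n :> R by apply: exprn_ege1; lra.
move=> hx hy; rewrite phi_dist -?normr_gt0; [|lra..].
rewrite mulrC ler_wpM2r // expr_div_n expr1n div1r lef_pV2 ?posrE; [|nra|lra].
by nra.
Qed.

Lemma deep_cyl_diam M n x y : deep_cyl M n x -> deep_cyl M n y ->
  `|x - y| <= (1 / 2) ^+ n.
Proof.
have near z : deep_cyl M n z -> `|z - lval R (nth_letter n)| <= (1 / 2) ^+ n / 2.
  move=> nz; have := deep_cyl_far nz; case: nz => _ zn.
  move=> h; have -> : z - lval R (nth_letter n) = - (shift z + lval R (nth_letter n))^-1.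
    by rewrite -{1}(phi_shift z) zn /phi; ring.
  rewrite normrN normfV.
  rewrite expr_div_n expr1n div1r -invfM lef_pV2 ?posrE; [lra| |].
    by apply: lt_le_trans h; rewrite mulr_gt0 // exprn_gt0.
  by rewrite mulr_gt0 // exprn_gt0.
move=> /near hx /near hy.
have := ler_normB (x - lval R (nth_letter n)) (y - lval R (nth_letter n)).
by rewrite (_ : _ - _ - _ = x - y); [lra|ring].
Qed.

(* Writing p = 2^-s, the cylinder of the n-th letter has s-content at most p^n;
   each application of the contractions phi multiplies this bound by
   sum_(n >= M) p^n <= 1/2. *)
Lemma cov_deep_cyl (s : R) M k n : 0 < s ->
  (1 / 2 `^ s) ^+ M / (1 - 1 / 2 `^ s) <= 1 / 2 ->
  cov s (deep_cyl M n) ((1 / 2) ^+ k * (1 / 2 `^ s) ^+ n)%:E.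
Proof.
move=> s0; set p : R := 1 / 2 `^ s => pM.
have two_s : 1 < 2 `^ s :> R.
  rewrite [ltLHS](_ : _ = 1 `^ s); last by rewrite powR1.
  by rewrite gt0_ltr_powR // ?nnegrE ?ltr1n.
have p0 : 0 < p by rewrite divr_gt0 //; lra.
have p1 : p < 1 by rewrite ltr_pdivrMr; lra.
have pE m : ((1 / 2) ^+ m) `^ s = p ^+ m.
  elim: m => [|m IH]; first by rewrite !expr0 powR1.
  rewrite !exprS powRM ?IH ?divr_ge0 ?exprn_ge0 ?divr_ge0 //; congr (_ * _).
  by rewrite /p !div1r -powRN -mulN1r powRrM powR_inv1.
elim: k n => [|k IH] n.
  rewrite expr0 mul1r -pE; apply: cov_diam => //.
  by move=> x y; exact: deep_cyl_diam.
pose F := deep M `&` [set y | 2 * 2 ^+ n <= `|y + lval R (nth_letter n)|].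
apply: (@cov_le _ _ _ (phi (nth_letter n) @` F)
  ((((1 / 2) ^+ n) `^ s)%:E * ((1 / 2) ^+ k * (1 / 2))%:E)%E).
- move=> x nx; exists (shift x); last by case: nx => _ <-; exact: phi_shift.
  by split; [case: nx => + _; exact: deep_shift|exact: deep_cyl_far nx].
- by rewrite pE -EFinM lee_fin exprSr mulrC.
apply: cov_image; first by rewrite exprn_ge0 // divr_ge0.
  by move=> x y [_ hx] [_ hy]; exact: phi_contract.
(* Covering [deep M] by all its cylinders at stage k costs at most 2^-k p^M/(1 - p) <= 2^-(k+1). *)
apply: cov_le (cov_bigcup (fun m => IH (m + M)%N)).
  by move=> x [/deep_cyl_bigcup].
have cE m : ((1 / 2) ^+ k * p ^+ (m + M))%:E = (((1 / 2) ^+ k * p ^+ M) * p ^+ m)%:E.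
  by rewrite -mulrA -exprD addnC.
rewrite (eq_eseriesr (fun m _ => cE m)).
apply: le_trans (geometric_eseries_le _ (ltW p0) p1) _.
  by rewrite mulr_ge0 // exprn_ge0 // ?divr_ge0 // ltW.
by rewrite lee_fin -mulrA ler_wpM2l // exprn_ge0 // divr_ge0.
Qed.

(** [M] depends on [s]: it makes p^M/(1 - p) at most 1/2. Letting k grow then makes every cylinder
    null. *)
Lemma null_deep (s : R) : 0 < s -> exists M, null s (deep M).
Proof.
move=> s0; set p : R := 1 / 2 `^ s.
have two_s : 1 < 2 `^ s :> R.
  rewrite [ltLHS](_ : _ = 1 `^ s); last by rewrite powR1.
  by rewrite gt0_ltr_powR // ?nnegrE ?ltr1n.
have p0 : 0 < p by rewrite divr_gt0 //; lra.
have p1 : p < 1 by rewrite ltr_pdivrMr; lra.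
have small (q e : R) : 0 <= q -> q < 1 -> 0 < e -> exists n, q ^+ n < e.
  move=> q0 q1 e0; have : q ^+ n @[n --> \oo] --> (0 : R).
    by apply: cvg_expr; rewrite ger0_norm.
  move=> /cvgrPdist_lt/(_ e e0)[n _ /(_ n (leqnn n))].
  by rewrite sub0r normrN ger0_norm ?exprn_ge0 // => h; exists n.
have [|M pM] := small p ((1 - p) / 2) (ltW p0) p1; first by lra.
exists M; apply: (null_subset (@deep_cyl_bigcup M)); apply: null_bigcup => n e e0.
have [k ke] := small (1 / 2) e ltac:(lra) ltac:(lra) e0.
have pM' : p ^+ M / (1 - p) <= 1 / 2 by rewrite ler_pdivrMr; lra.
apply: cov_le (cov_deep_cyl k (n + M) s0 pM') => //; rewrite lee_fin.
apply: le_trans (ltW ke); rewrite ler_piMr ?exprn_ge0 ?divr_ge0 //.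
by rewrite exprn_ile1 // ltW.
Qed.

(* Points whose k-th shift is either a letter or lies in deep M. *)
Fixpoint tail M k : set R :=
  if k is k'.+1 then
    \bigcup_n [set phi (nth_letter n) y | y in
                 tail M k' `&` [set y | 1 <= `|y + lval R (nth_letter n)|]]
  else deep M `|` \bigcup_n [set lval R (nth_letter n)].

(** [phi] is 1-Lipschitz where its denominator has modulus at least 1, and prepending letters is a
    countable operation. *)
Lemma null_tail (s : R) M k : 0 < s -> null s (deep M) -> null s (tail M k).
Proof.
move=> s0 nM; elim: k => [|k IH] /=.
  apply: (@null_subset _ _ _ (\bigcup_n
      if n is n'.+1 then [set lval R (nth_letter n')] else deep M)).
    by move=> x [Mx|[n _ xn]]; [exists 0%N|exists n.+1].
  by apply: null_bigcup => -[//|n]; exact: null_set1.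
apply: null_bigcup => n e e0.
suff : cov s [set phi (nth_letter n) y | y in
                 tail M k `&` [set y | 1 <= `|y + lval R (nth_letter n)|]]
         ((1 `^ s)%:E * e%:E)%E by rewrite powR1 mul1e.
apply: cov_image => //; last first.
  by apply: cov_le (IH e e0) => // x [].
move=> x y [_ /= hx] [_ /= hy].
rewrite phi_dist -?normr_gt0; [|lra..].
rewrite mul1r ler_pdivrMr; last by nra.
by rewrite ler_peMr //; nra.
Qed.

Lemma tail_shift M k x : (forall j, (j < k)%N -> coded (iter j (@shift R) x)) ->
  tail M 0 (iter k (@shift R) x) -> tail M k x.
Proof.
elim: k x => [//|k IH] x ck tx.
have [n xn] := nth_letter_surj (nu x).
exists n => //; exists (shift x); last by rewrite -xn phi_shift.
split; last by rewrite /= -xn; have := coded_ge2 (ck 0%N isT) => /=; lra.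
by apply: IH => [j jk|]; rewrite -iterSr //; exact: ck.
Qed.

Lemma transient_tail (o : R * R) M : hplane o ->
  transient_limit_set (@grp R) o `<=` \bigcup_k tail M k.
Proof.
move=> o0 x tx; have Lx := limit_point_end o0 tx.1.
have [[k ck]|call] := pselect (exists k, ~ coded (iter k (@shift R) x)).
  (* Finite code: at the first uncoded shift the point is still an end limit, so it equals the value
     of its letter. *)
  have [j nj minj] := ex_minnP (ex_intro (fun k => ~~ `[< coded (iter k (@shift R) x) >]) k
                        (introN (asboolP _) ck)).
  have cj i : (i < j)%N -> coded (iter i (@shift R) x).
    by move=> ij; apply: contrapT => /asboolPn/minj; rewrite leqNgt ij.
  have Lj : end_limit (iter j (@shift R) x).
    by case: j cj {nj minj} => [//|j] cj; apply: coded_end_limit; exact: cj.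
  exists j => //; apply: tail_shift => //; right.
  have [n xn] := nth_letter_surj (nu (iter j (@shift R) x)).
  exists n => //=; rewrite -xn; apply: contrapT => /eqP ne.
  by move: nj => /asboolPn; apply.
have {}call i : coded (iter i (@shift R) x).
  by apply: contrapT => ni; apply: call; exists i.
(* Infinite code: letters below [M] infinitely often would contradict transience. *)
have [k kM] : exists k, forall i, (k <= i)%N -> (M <= (nu (iter i (@shift R) x)).2)%N.
  apply: contrapT => nk; apply: (@recurrent_not_transient R x o M) => // k.
  apply: contrapT => ni; apply: nk; exists k => i ki; rewrite leqNgt.
  by apply/negP => iM; apply: ni; exists i.
exists k => //; apply: tail_shift => //; left => i.
by rewrite -iterD; split => //; apply: kM; exact: leq_addl.
Qed.

End Dimension.

Theorem theorem2 (R : realType) :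
  exists G : set 'M[R]_2,
    [/\ Fuchsian G, torsion_free G, infinitely_generated G &
        forall o : R * R, hplane o ->
          hausdorff_dim (transient_limit_set G o) = 0%E].
Proof.
exists (@grp R); split.
- exact: grp_Fuchsian.
- exact: grp_torsion_free.
- exact: grp_infinitely_generated.
move=> o o0; apply: null_hausdorff_dim => s s0.
have [M nM] := null_deep s0.
apply: (null_subset (@transient_tail R o M o0)).
by apply: null_bigcup => k; exact: null_tail.
Qed.
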